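(* Let $A, B \in M_+(n,\mathbb{C})$ and $X \in M(n,\mathbb{C})$. Then $$\left\| \int_0^1 A^{\nu}XB^{1-\nu}\,d\nu \right\|_F \le \left\| \frac{AX + 3A^{1/3}XB^{2/3} + 3A^{2/3}XB^{1/3} + XB}{8} \right\|_F \le \frac{1}{3}\left\| 2A^{1/2}XB^{1/2} + \frac{AX + XB}{2}\right\|_F .$$
   Context: $M(n,\mathbb{C})$ is the set of all $n\times n$ complex matrices and $M_+(n,\mathbb{C})$ is the set of all $n\times n$ positive semidefinite complex matrices. $\|A\|_F = \left(\sum_{i,j=1}^n |a_{ij}|^2\right)^{1/2} = (\mathrm{Tr}[A^*A])^{1/2}$ is the Frobenius (Hilbert-Schmidt) norm. Powers of positive semidefinite matrices are defined by the functional calculus, and the integral is taken entrywise. *)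

(* Defs.v *)
From mathcomp Require Import all_boot all_order all_algebra.
From mathcomp Require Import sesquilinear spectral.
From mathcomp Require Import complex.
From mathcomp Require Import all_classical all_reals all_analysis.

Set Implicit Arguments.
Unset Strict Implicit.
Unset Printing Implicit Defensive.

Import Order.TTheory GRing.Theory Num.Theory.
Import numFieldNormedType.Exports.

Local Open Scope classical_set_scope.
Local Open Scope ring_scope.
Local Open Scope complex_scope.
Local Open Scope sesquilinear_scope.

(* The order on R[i] is partial: 0 <= z means that z is real and
   nonnegative. *)
Definition psdmx (R : realType) (n : nat) (A : 'M[R[i]]_n) : Prop :=
  A \is hermsymmx /\
  forall v : 'cV[R[i]]_n, 0 <= (v ^t* *m A *m v) ord0 ord0.

(* Functional calculus for a Hermitian A = U^-1 diag(d) U, with U unitary and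
   d real. The result does not depend on the chosen diagonalization. *)
Definition mxcalc (R : realType) (n : nat) (f : R -> R) (A : 'M[R[i]]_n) :
    'M[R[i]]_n :=
  invmx (spectralmx A)
    *m diag_mx (map_mx (fun z : R[i] => (f (complex.Re z))%:C) (spectral_diag A))
    *m spectralmx A.

(* Since 0 `^ 0 = 1, mxpow A 0 is the identity even for a singular A. *)
Definition mxpow (R : realType) (n : nat) (A : 'M[R[i]]_n) (s : R) :
    'M[R[i]]_n :=
  mxcalc (fun x : R => x `^ s) A.

Definition frobenius (R : realType) (m n : nat) (A : 'M[R[i]]_(m, n)) : R :=
  Num.sqrt (\sum_(i < m) \sum_(j < n) (Normc.normc (A i j)) ^+ 2).

Definition mxintegral (R : realType) (m n : nat) (D : set R)
    (F : R -> 'M[R[i]]_(m, n)) : 'M[R[i]]_(m, n) :=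
  \matrix_(i < m, j < n)
    Complex (\int[lebesgue_measure]_(t in D) complex.Re (F t i j))
            (\int[lebesgue_measure]_(t in D) complex.Im (F t i j)).

(* Main.v *)
(** Diagonalize A = U^-1 diag(a) U and B = V^-1 diag(b) V, and put Y = U X V^-1.
    Every matrix in the statement is U^-1 (c(a_i, b_j) Y_ij) V for some kernel
    c >= 0, and the Frobenius norm is unitarily invariant, so it suffices to
    compare the kernels entrywise:
      int_0^1 a^t b^(1-t) dt <= ((a^(1/3) + b^(1/3)) / 2)^3
                             <= (2 sqrt(a b) + (a + b) / 2) / 3.
    The left-hand side is the logarithmic mean of a and b when both are
    positive, and 0 when one of them vanishes. *)
Require Import Defs.
From mathcomp Require Import all_boot all_order all_algebra.
From mathcomp Require Import sesquilinear spectral complex ring lra.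
From mathcomp Require Import all_classical all_reals all_analysis.
From mathcomp Require Import measurable_realfun.

Set Implicit Arguments.
Unset Strict Implicit.
Unset Printing Implicit Defensive.

Import Order.TTheory GRing.Theory Num.Theory.
Import numFieldNormedType.Exports.

Local Open Scope classical_set_scope.
Local Open Scope ring_scope.
Local Open Scope complex_scope.
Local Open Scope sesquilinear_scope.

(** * Scalar inequalities between the three kernels *)

(* The difference of the two sides vanishes at r = 1 and has derivative
   (r - 1)^4 / (r (r + 1)^4). *)
Lemma ln_ge_cubic (R : realType) (r : R) : 1 <= r ->
  8 * (r ^+ 3 - 1) / (3 * (r + 1) ^+ 3) <= ln r.
Proof.
move=> r1.
pose g (x : R) := ln x - 8 / 3 * ((x ^+ 3 - 1) * ((x + 1)^-1) ^+ 3).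
pose dg (x : R) := (x - 1) ^+ 4 / (x * (x + 1) ^+ 4).
have gE (x : R) : 1 <= x -> is_derive x 1 g (dg x).
  move=> x1.
  have x0 : 0 < x by lra.
  have x10 : x + 1 != 0 by apply: lt0r_neq0; lra.
  have dV : is_derive x 1 (fun y : R => (y + 1)^-1) (- (x + 1) ^- 2).
    apply: is_derive_eq.
    by rewrite /GRing.scale /= addr0 mulr1.
  have dln := is_derive1_ln x0.
  apply: is_derive_eq.
  rewrite /dg /GRing.scale /=.
  by field; rewrite x10 gt_eqF.
have [||c c1r] := @MVT_segment R g dg 1 r r1.
- by move=> x; rewrite in_itv/= => /andP[x1 _]; exact/gE/ltW.
- apply: derivable_within_continuous => x; rewrite in_itv/= => /andP[x1 _].
  exact: (@ex_derive _ _ _ _ _ _ _ (gE x x1)).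
have cge1 : 1 <= c by move: c1r; rewrite in_itv/= => /andP[].
have dg0 : 0 <= dg c.
  by rewrite /dg divr_ge0 ?mulr_ge0 ?exprn_even_ge0 ?exprn_ge0//; lra.
have r10 : r + 1 != 0 by apply: lt0r_neq0; lra.
rewrite /g ln1 expr1n subrr mul0r mulr0 !subr0 => E.
have : 0 <= dg c * (r - 1) by rewrite mulr_ge0// subr_ge0.
rewrite -E subr_ge0; congr (_ <= _).
by field.
Qed.

Lemma integrable_powR_mul (R : realType) (a b : R) : 0 <= a -> 0 <= b ->
  (@lebesgue_measure R).-integrable `[0, 1]
    (EFin \o (fun t : R => a `^ t * b `^ (1 - t))).
Proof.
move=> a0 b0; apply: measurable_bounded_integrable => //.
- by rewrite /= lebesgue_measure_itv/= lte_fin ltr01 -EFinD ltry.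
- apply: measurable_funS (measurableT) _ _ => //.
  apply: measurable_funM; first exact: measurable_powRr.
  apply: measurableT_comp; first exact: measurable_powRr.
  exact: measurable_funB.
(* The power is at most [x] when [1 <= x] and at most 1 when [x < 1]; [1 + x] dominates both cases,
   including 0 to the power 0, which is 1. *)
- have bnd (x t : R) : 0 <= x -> 0 <= t <= 1 -> x `^ t <= 1 + x.
    move=> x0 /andP[t0 t1]; have [x1|x1] := leP 1 x.
      by rewrite (le_trans (ler1_powR x1 t1))// lerDr.
    move: x0; rewrite le_eqVlt => /predU1P[<-|x0].
      by rewrite /powR eqxx addr0; case: (t == 0); rewrite ?lexx ?ler01.
    rewrite -(powRr0 x); apply: (@le_trans _ _ (x `^ 0)).
      by rewrite ger_powR// x0 ltW.
    by rewrite lerDl ltW.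
  exists ((1 + a) * (1 + b)); split; first exact: num_real.
  move=> M ltM t /=; rewrite in_itv/= => /andP[t0 t1].
  apply/ltW/(le_lt_trans _ ltM).
  rewrite ger0_norm ?mulr_ge0 ?powR_ge0//.
  by rewrite ler_pM ?powR_ge0// bnd ?t0 ?t1//; lra.
Qed.

(** With [u = ln a - ln b] the integrand is the exponential of [u * t + ln b]; as [u] is nonzero,
    dividing by [u] gives a primitive. *)
Lemma Rintegral_powR_mul (R : realType) (a b : R) : 0 < a -> 0 < b -> a != b ->
  \int[lebesgue_measure]_(t in `[0, 1]) (a `^ t * b `^ (1 - t))
    = (a - b) / (ln a - ln b).
Proof.
move=> a0 b0 ab.
pose u := ln a - ln b.
have u0 : u != 0.
  by rewrite subr_eq0; apply: contra ab => /eqP/ln_inj ->//; rewrite ?posrE.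
pose F (t : R) := u^-1 * expR (u * t + ln b).
pose f (t : R) := expR (u * t + ln b).
have fE (t : R) : a `^ t * b `^ (1 - t) = f t.
  rewrite /powR !gt_eqF// -expRD /f /u; congr expR; ring.
have dF (x : R) : is_derive x 1 F (f x).
  apply: is_derive_eq; rewrite /GRing.scale /= /f; field; exact: u0.
have df (x : R) : is_derive x 1 f (u * f x).
  apply: is_derive_eq; rewrite /GRing.scale /= /f; ring.
have cF (x : R) : {for x, continuous F}.
  apply/differentiable_continuous/derivable1_diffP; apply: ex_derive.
have cf : {within `[(0:R), 1], continuous f}.
  by apply: derivable_within_continuous => x _; apply: ex_derive.
rewrite /Rintegral; under eq_integral do rewrite fE.
rewrite (continuous_FTC2 ltr01 cf (F := F)).
- rewrite /= /F mulr0 add0r lnK ?posrE// mulr1 /u subrK lnK ?posrE//.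
  by rewrite -mulrBr mulrC.
- split.
  + by move=> x _; apply: ex_derive.
  + exact/cvg_at_right_filter/cF.
  + exact/cvg_at_left_filter/cF.
- by move=> x _; rewrite derive1E; apply: derive_val.
Qed.

(** This is [ln_ge_cubic] at the ratio [x / y], made homogeneous. Taking cubes as arguments makes
    the cube roots of the kernel the variables. *)
Lemma log_mean_le (R : realType) (x y : R) : 0 < y -> y < x ->
  (x ^+ 3 - y ^+ 3) / (ln (x ^+ 3) - ln (y ^+ 3)) <= ((x + y) / 2) ^+ 3.
Proof.
move=> y0 yx; have x0 := lt_trans y0 yx.
have r1 : 1 <= x / y by rewrite ler_pdivlMr// mul1r ltW.
have := ln_ge_cubic r1.
rewrite ln_div ?posrE// => H.
have l0 : 0 < ln x - ln y by rewrite subr_gt0 ltr_ln ?posrE.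
rewrite !lnXn// -mulrnBl ler_pdivrMr; last by rewrite pmulrn_lgt0.
have xy0 : 0 < x + y by lra.
(* The factor [*+ 3] matches the 3 that came out of the logarithms of the cubes. *)
have -> : x ^+ 3 - y ^+ 3 = ((x + y) / 2) ^+ 3 *
   (8 * ((x / y) ^+ 3 - 1) / (3 * (x / y + 1) ^+ 3) *+ 3).
  field; rewrite !gt_eqF//=.
by rewrite ler_wpM2l ?ler_wMn2r// exprn_ge0// divr_ge0// ltW.
Qed.

Lemma Rintegral_powR_mul_le (R : realType) (a b : R) : 0 <= a -> 0 <= b ->
  \int[lebesgue_measure]_(t in `[0, 1]) (a `^ t * b `^ (1 - t))
    <= ((a `^ (1 / 3) + b `^ (1 / 3)) / 2) ^+ 3.
Proof.
move=> a0 b0.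
have cube (x : R) : 0 <= x -> x = (x `^ (1 / 3)) ^+ 3.
  move=> x0; rewrite -powR_mulrn ?powR_ge0// -powRrM.
  by rewrite divfK ?powRr1// pnatr_eq0.
have [->|an0] := eqVneq a 0.
  (* At [t = 0] the integrand is [b], since 0 to the power 0 is 1. Dropping this null endpoint
     leaves the zero function. The case [b = 0] drops [t = 1] instead. *)
  rewrite -Rintegral_itv_obnd_cbnd; last first.
    apply: integrableS (integrable_powR_mul (lexx 0) b0) => //.
    by apply: subset_itvr; rewrite bnd_simp.
  rewrite (@eq_Rintegral _ _ _ _ _ (cst 0)).
    rewrite Rintegral_cst// mul0r.
    by rewrite exprn_ge0// divr_ge0// addr_ge0// powR_ge0.
  move=> t; rewrite inE/= in_itv/= => /andP[t0 _].
  by rewrite powR0 ?mul0r ?gt_eqF.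
have [->|bn0] := eqVneq b 0.
  rewrite -Rintegral_itv_bndo_bndc; last first.
    apply: integrableS (integrable_powR_mul a0 (lexx 0)) => //.
    by apply: subset_itvl; rewrite bnd_simp.
  rewrite (@eq_Rintegral _ _ _ _ _ (cst 0)).
    rewrite Rintegral_cst// mul0r.
    by rewrite exprn_ge0// divr_ge0// addr_ge0// powR_ge0.
  move=> t; rewrite inE/= in_itv/= => /andP[_ t1].
  by rewrite (@powR0 _ (1 - t)) ?mulr0// gt_eqF// subr_gt0.
have ap : 0 < a by rewrite lt0r an0.
have bp : 0 < b by rewrite lt0r bn0.
(* On the diagonal the logarithmic mean formula would be 0 / 0, but the integrand is constant. *)
have [<-|ab] := eqVneq a b.
  rewrite (@eq_Rintegral _ _ _ _ _ (cst a)); last first.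
    by move=> t _; rewrite -powRD ?an0 ?implybT// subrKC powRr1.
  rewrite Rintegral_cst// [fine _](_ : _ = 1) ?mulr1.
    by rewrite [leLHS]cube// le_eqVlt; apply/orP; left; apply/eqP; field.
  by rewrite /= lebesgue_measure_itv/= lte_fin ltr01 /= subr0.
rewrite Rintegral_powR_mul//.
have p3 (x : R) : 0 < x -> 0 < x `^ (1 / 3) by exact: powR_gt0.
(* Swapping [a] and [b] changes the sign of both numerator and denominator. *)
wlog: a b a0 b0 ap bp ab an0 bn0 / b < a.
  move=> H; move: ab; rewrite neq_lt => /orP[ab|ab].
    rewrite -(opprB b a) -(opprB (ln b) (ln a)) invrN mulrNN.
    by rewrite [X in (X / 2)]addrC H// gt_eqF.
  by rewrite H// gt_eqF.
move=> ba; rewrite {1 2}(cube a)// {1 2}(cube b)//.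
by rewrite log_mean_le ?p3// gt0_ltr_powR ?nnegrE.
Qed.

(** In terms of sixth roots [p], [q] both sides are polynomials, and their difference factors as
    [(p - q) ^+ 4] times a polynomial with nonnegative coefficients. *)
Lemma cube_mean_le (R : realType) (a b : R) : 0 <= a -> 0 <= b ->
  ((a `^ (1 / 3) + b `^ (1 / 3)) / 2) ^+ 3
    <= 1 / 3 * (2 * (a `^ (1 / 2) * b `^ (1 / 2)) + (a + b) / 2).
Proof.
move=> a0 b0.
pose p := a `^ (1 / 6); pose q := b `^ (1 / 6).
have pw (x : R) n : 0 <= x -> (x `^ (1 / 6)) ^+ n = x `^ (n%:R / 6).
  by move=> x0; rewrite -powR_mulrn ?powR_ge0// -powRrM; congr (_ `^ _); field.
have h3 (x : R) : 0 <= x -> x `^ (1 / 3) = (x `^ (1 / 6)) ^+ 2.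
  by move=> x0; rewrite pw//; congr (_ `^ _); field.
have h2 (x : R) : 0 <= x -> x `^ (1 / 2) = (x `^ (1 / 6)) ^+ 3.
  by move=> x0; rewrite pw//; congr (_ `^ _); field.
have h1 (x : R) : 0 <= x -> x = (x `^ (1 / 6)) ^+ 6.
  by move=> x0; rewrite pw// divff ?powRr1// pnatr_eq0.
rewrite !h3// !h2// [X in _ + (X + _) / 2]h1// [X in _ + (_ + X) / 2]h1//.
rewrite -/p -/q -subr_ge0.
have -> : 1 / 3 * (2 * (p ^+ 3 * q ^+ 3) + (p ^+ 6 + q ^+ 6) / 2)
   - ((p ^+ 2 + q ^+ 2) / 2) ^+ 3
   = (p - q) ^+ 4 * (p ^+ 2 + 4 * (p * q) + q ^+ 2) / 24 by field.
have pq0 : 0 <= p * q by rewrite mulr_ge0 ?powR_ge0.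
rewrite divr_ge0// mulr_ge0 ?exprn_even_ge0// !addr_ge0 ?sqr_ge0//.
by rewrite mulr_ge0.
Qed.

(** * Finite sums of integrals and unitary invariance of the Frobenius norm *)

Lemma Rintegral_sum d (T : measurableType d) (R : realType)
    (mu : {measure set T -> \bar R}) (D : set T) (I : Type) (s : seq I)
    (h : I -> T -> R) : measurable D ->
  (forall i, mu.-integrable D (EFin \o h i)) ->
  \int[mu]_(x in D) (\sum_(i <- s) h i x) = \sum_(i <- s) \int[mu]_(x in D) h i x.
Proof.
move=> mD ih; elim: s => [|i s IHs].
  under eq_Rintegral do rewrite big_nil.
  by rewrite Rintegral_cst// mul0r big_nil.
under eq_Rintegral do rewrite big_cons.
rewrite big_cons -IHs RintegralD//.
have -> : EFin \o (fun x => \sum_(j <- s) h j x) =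
    (fun x => \sum_(j <- s) (EFin \o h j) x)%E.
  by apply/funext => x /=; rewrite sumEFin.
exact: integrable_sum.
Qed.

Lemma sqr_frobenius (R : realType) m n (M : 'M[R[i]]_(m, n)) :
  (frobenius M ^+ 2)%:C = \tr (M *m M^t*).
Proof.
rewrite /frobenius sqr_sqrtr; last first.
  by apply: sumr_ge0 => i _; apply: sumr_ge0 => j _; exact: sqr_ge0.
rewrite rmorph_sum; apply: eq_bigr => i _; rewrite rmorph_sum mxE.
by apply: eq_bigr => j _; rewrite !mxE -normCK -rmorphXn.
Qed.

(** In the trace form of the squared norm, [V] cancels against its adjoint at once, and [U] does so
    after a cyclic permutation. *)
Lemma frobenius_unitary (R : realType) n (U V M : 'M[R[i]]_n) :
  U \is unitarymx -> V \is unitarymx -> frobenius (U *m M *m V) = frobenius M.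
Proof.
move=> uU uV; apply/eqP; rewrite -(@eqrXn2 _ 2) ?sqrtr_ge0//; apply/eqP.
apply: (@complexI R); rewrite !sqr_frobenius !trmx_mul !map_mxM.
rewrite !mulmxA mulmxtVK// mxtrace_mulC !mulmxA.
have UU : U^t* *m U = 1%:M.
  rewrite -(invmx_unitary uU).
  by apply: mulVmx; have := unitarymx_unit uU.
by rewrite UU mul1mx.
Qed.

Lemma frobeniusZ (R : realType) m n (k : R) (M : 'M[R[i]]_(m, n)) :
  0 <= k -> frobenius (k%:C *: M) = k * frobenius M.
Proof.
move=> k0; rewrite /frobenius -{2}(ger0_norm k0) -sqrtr_sqr -sqrtrM ?sqr_ge0//.
congr Num.sqrt; rewrite mulr_sumr; apply: eq_bigr => i _.
rewrite mulr_sumr; apply: eq_bigr => j _.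
by rewrite mxE Normc.normcM /= expr0n addr0 sqrtr_sqr ger0_norm// exprMn.
Qed.

(** * Schur multipliers with fixed outer factors *)

Section SchurMultiplier.
Variables (R : realType) (n : nat) (P Q Y : 'M[R[i]]_n).

(** The Schur (entrywise) product of [Y] with a real kernel, seen through [P] and [Q]. With these
    fixed, the matrix depends linearly on the kernel [c]. *)
Definition schur_conj (c : 'I_n -> 'I_n -> R) : 'M[R[i]]_n :=
  P *m (\matrix_(i, j) ((c i j)%:C * Y i j)) *m Q.

Lemma schur_conjD c c' :
  schur_conj c + schur_conj c' = schur_conj (fun i j => c i j + c' i j).
Proof.
rewrite /schur_conj -mulmxDl -mulmxDr; congr (_ *m _ *m _).
by apply/matrixP => i j; rewrite !mxE rmorphD mulrDl.
Qed.

Lemma schur_conjZ (k : R) c :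
  k%:C *: schur_conj c = schur_conj (fun i j => k * c i j).
Proof.
rewrite /schur_conj scalemxAl scalemxAr; congr (_ *m _ *m _).
by apply/matrixP => i j; rewrite !mxE rmorphM mulrA.
Qed.

Lemma frobenius_schur_conj_le c c' :
  P \is unitarymx -> Q \is unitarymx ->
  (forall i j, 0 <= c i j <= c' i j) ->
  frobenius (schur_conj c) <= frobenius (schur_conj c').
Proof.
move=> uP uQ cc'; rewrite !frobenius_unitary// ler_wsqrtr//.
apply: ler_sum => i _; apply: ler_sum => j _.
have /andP[c0 cc] := cc' i j.
have normC0 (x : R) : 0 <= x -> Normc.normc x%:C = x.
  by move=> x0; rewrite /= expr0n addr0 sqrtr_sqr ger0_norm.
rewrite !mxE !Normc.normcM !normC0//; last exact: le_trans cc.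
have n0 : 0 <= Normc.normc (Y i j) by case: (Y i j) => u v; exact: sqrtr_ge0.
by rewrite lerXn2r ?nnegrE ?mulr_ge0 ?ler_wpM2r//; exact: le_trans cc.
Qed.

(** Each entry is a finite combination of kernel values with coefficients independent of [t], so
    integration passes to the kernel, separately in real and imaginary parts. *)
Lemma mxintegral_schur_conj (D : set R) (c : R -> 'I_n -> 'I_n -> R) :
  measurable D ->
  (forall i j, (@lebesgue_measure R).-integrable D (EFin \o (fun t => c t i j))) ->
  mxintegral D (fun t => schur_conj (c t)) =
  schur_conj (fun i j => \int[lebesgue_measure]_(t in D) c t i j).
Proof.
move=> mD ic; apply/matrixP => i j; rewrite mxE.
pose w (p : 'I_n * 'I_n) := P i p.1 * Y p.1 p.2 * Q p.2 j.
have entryE c' : schur_conj c' i j = \sum_p (c' p.1 p.2)%:C * w p.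
  rewrite !mxE -(pair_big xpredT xpredT (fun k l => (c' k l)%:C * w (k, l)))/=.
  rewrite exchange_big /=; apply: eq_bigr => k _.
  rewrite mxE mulr_suml; apply: eq_bigr => l _.
  by rewrite mxE /w /= mulrCA !mulrA.
have ReE c' : complex.Re (schur_conj c' i j) =
    \sum_p c' p.1 p.2 * complex.Re (w p).
  rewrite entryE (big_morph (@complex.Re R) (id1 := 0) (op1 := +%R))//;
    last by case=> ? ? [].
  by apply: eq_bigr => p _; case: (w p) => u v /=; rewrite mul0r subr0.
have ImE c' : complex.Im (schur_conj c' i j) =
    \sum_p c' p.1 p.2 * complex.Im (w p).
  rewrite entryE (big_morph (@complex.Im R) (id1 := 0) (op1 := +%R))//;
    last by case=> ? ? [].
  by apply: eq_bigr => p _; case: (w p) => u v /=; rewrite mul0r addr0.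
have ick r p : (@lebesgue_measure R).-integrable D
    (EFin \o (fun t => c t p.1 p.2 * r)).
  have -> : EFin \o (fun t => c t p.1 p.2 * r) =
      (fun t => (r%:E * (EFin \o (fun t => c t p.1 p.2)) t)%E).
    by apply/funext => t /=; rewrite muleC -EFinM.
  exact: integrableZl.
apply/eqP; rewrite eq_complex /= ReE ImE; apply/andP; split; apply/eqP.
  under eq_Rintegral do rewrite ReE.
  rewrite Rintegral_sum//; apply: eq_bigr => p _.
  by rewrite RintegralZr.
under eq_Rintegral do rewrite ImE.
rewrite Rintegral_sum//; apply: eq_bigr => p _.
by rewrite RintegralZr.
Qed.

End SchurMultiplier.

(** * Spectral calculus of positive semidefinite matrices *)

Lemma psdmx_spectral_diag (R : realType) n (A : 'M[R[i]]_n) (k : 'I_n) :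
  psdmx A -> 0 <= spectral_diag A ord0 k.
Proof.
case=> hA; set U := spectralmx A.
have uU : U \is unitarymx by exact: spectral_unitarymx.
have /hermitian_normalmx /orthomx_spectralP := hA; rewrite -/U.
set S := spectral_diag A => ->.
(* This test vector is the [k]-th eigenvector, so the quadratic form returns exactly the [k]-th
   eigenvalue. *)
move=> /(_ (U^t* *m delta_mx k 0)).
rewrite trmx_mul map_mxM trmxCK trmx_delta map_delta_mx.
rewrite !mulmxA invmx_unitary// mulmxtVK// -[_ *m U *m _]mulmxA.
rewrite (unitarymxP uU) mulmx1 -rowE row_diag_mx -scalemxAl mul_delta_mx.
by rewrite !mxE !eqxx mulr1.
Qed.

(** In the two eigenbases, the left diagonal factor scales rows and the right one scales columns. *)
Lemma mxcalc_sandwich (R : realType) n (f g : R -> R) (A B X : 'M[R[i]]_n) :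
  mxcalc f A *m X *m mxcalc g B =
  schur_conj (invmx (spectralmx A)) (spectralmx B)
    (spectralmx A *m X *m invmx (spectralmx B))
    (fun i j => f (complex.Re (spectral_diag A ord0 i)) *
                g (complex.Re (spectral_diag B ord0 j))).
Proof.
pose DA := map_mx (fun z : R[i] => (f (complex.Re z))%:C) (spectral_diag A).
pose DB := map_mx (fun z : R[i] => (g (complex.Re z))%:C) (spectral_diag B).
pose Y := spectralmx A *m X *m invmx (spectralmx B).
transitivity
  (invmx (spectralmx A) *m (diag_mx DA *m Y *m diag_mx DB) *m spectralmx B).
  by rewrite /mxcalc !mulmxA.
congr (_ *m _ *m _); apply/matrixP => i j.
rewrite mul_mx_diag mul_diag_mx !mxE rmorphM.
by rewrite [RHS]mulrAC.
Qed.

(** The eigenvalues are nonnegative in the order of [R[i]], hence real: [complex.Re] discards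
    nothing and the power 1 fixes them. *)
Lemma mxpow1 (R : realType) n (A : 'M[R[i]]_n) : psdmx A -> mxpow A 1 = A.
Proof.
move=> hA; have /hermitian_normalmx /orthomx_spectralP AE := hA.1.
apply: etrans (esym AE); rewrite /mxpow /mxcalc; congr (_ *m diag_mx _ *m _).
apply/matrixP => i j; rewrite ord1 mxE.
have := psdmx_spectral_diag j hA; case: (spectral_diag A ord0 j) => u v.
by rewrite lecE /= => /andP[/eqP -> u0]; rewrite powRr1.
Qed.

Lemma mxpow0 (R : realType) n (A : 'M[R[i]]_n) : mxpow A 0 = 1%:M.
Proof.
rewrite /mxpow /mxcalc.
have -> : map_mx (fun z : R[i] => (complex.Re z `^ 0)%:C) (spectral_diag A) =
    const_mx 1.
  by apply/matrixP => i j; rewrite !mxE powRr0.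
by rewrite diag_const_mx mulmx1 mulVmx// spectral_unit.
Qed.

Theorem proposition1p3 (R : realType) (n : nat) (A B X : 'M[R[i]]_n)
    (hA : psdmx A) (hB : psdmx B) :
  frobenius (mxintegral `[0, 1]
               (fun nu : R => mxpow A nu *m X *m mxpow B (1 - nu)))
    <= frobenius (8^-1 *: (A *m X
                           + 3 *: (mxpow A (1 / 3) *m X *m mxpow B (2 / 3))
                           + 3 *: (mxpow A (2 / 3) *m X *m mxpow B (1 / 3))
                           + X *m B))
  /\
  frobenius (8^-1 *: (A *m X
                      + 3 *: (mxpow A (1 / 3) *m X *m mxpow B (2 / 3))
                      + 3 *: (mxpow A (2 / 3) *m X *m mxpow B (1 / 3))
                      + X *m B))
    <= 1 / 3 * frobenius (2 *: (mxpow A (1 / 2) *m X *m mxpow B (1 / 2))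
                          + 2^-1 *: (A *m X + X *m B)).
Proof.
pose a i := complex.Re (spectral_diag A ord0 i).
pose b i := complex.Re (spectral_diag B ord0 i).
have Re0 (C : 'M[R[i]]_n) i : psdmx C -> 0 <= complex.Re (spectral_diag C ord0 i).
  by move=> /(psdmx_spectral_diag i); rewrite lecE => /andP[].
have a0 i : 0 <= a i by exact: Re0.
have b0 i : 0 <= b i by exact: Re0.
pose T := schur_conj (invmx (spectralmx A)) (spectralmx B)
  (spectralmx A *m X *m invmx (spectralmx B)).
have TE s t : mxpow A s *m X *m mxpow B t = T (fun i j => a i `^ s * b j `^ t).
  by rewrite /mxpow mxcalc_sandwich.
have AXE : A *m X = T (fun i j => a i).
  (* Inserting the zeroth power of [B] on the right brings the product to the sandwich form of
     [TE]. *)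
  rewrite -[A in LHS]mxpow1// -[LHS]mulmx1 -(mxpow0 B) TE.
  by congr T; apply/funext => i; apply/funext => j; rewrite powRr0 powRr1 ?mulr1.
have XBE : X *m B = T (fun i j => b j).
  rewrite -[B in LHS]mxpow1// -[X in LHS]mul1mx -(mxpow0 A) TE.
  by congr T; apply/funext => i; apply/funext => j; rewrite powRr0 powRr1 ?mul1r.
have natC k : k%:R = (k%:R : R)%:C :> R[i] by rewrite rmorph_nat.
have natVC k : k%:R^-1 = (k%:R^-1 : R)%:C :> R[i] by rewrite fmorphV rmorph_nat.
have TD c c' : T c + T c' = T (fun i j => c i j + c' i j) by exact: schur_conjD.
have TZ k c : k%:C *: T c = T (fun i j => k * c i j) by exact: schur_conjZ.
have Tle c c' : (forall i j, 0 <= c i j <= c' i j) ->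
    frobenius (T c) <= frobenius (T c').
  apply: frobenius_schur_conj_le (spectral_unitarymx B).
  by rewrite invmx_unitary ?trmxC_unitary spectral_unitarymx.
have Tint : mxintegral `[0, 1] (fun t => T (fun i j => a i `^ t * b j `^ (1 - t)))
    = T (fun i j => \int[lebesgue_measure]_(t in `[0, 1])
                      (a i `^ t * b j `^ (1 - t))).
  rewrite /T mxintegral_schur_conj// => i j.
  by apply: integrable_powR_mul; [exact: a0|exact: b0].
(* From here on only the linearity, monotonicity and integration rules of [T] matter. *)
clearbody T a b.
pose cubic i j := ((a i `^ (1 / 3) + b j `^ (1 / 3)) / 2) ^+ 3.
have powE (x : R) k : 0 <= x -> x `^ (k%:R / 3) = (x `^ (1 / 3)) ^+ k.
  by move=> x0; rewrite -powR_mulrn ?powR_ge0// -powRrM; congr (_ `^ _); field.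
(* The weights 1, 3, 3, 1 over 8 are those of the binomial expansion of [cubic]. *)
have -> : 8^-1 *: (A *m X + 3 *: (mxpow A (1 / 3) *m X *m mxpow B (2 / 3))
    + 3 *: (mxpow A (2 / 3) *m X *m mxpow B (1 / 3)) + X *m B) = T cubic.
  rewrite [X in _ *: (_ + _ *: X + _ + _)]TE [X in _ *: (_ + _ *: X + _)]TE.
  rewrite AXE XBE (natC 3) (natVC 8) !(TZ 3) !TD TZ.
  congr T; apply/funext => i; apply/funext => j.
  rewrite /cubic (powE _ 2)// (powE _ 2)//.
  have cube (x : R) : 0 <= x -> x = (x `^ (1 / 3)) ^+ 3.
    by move=> x0; rewrite -powE// divff ?powRr1// pnatr_eq0.
  rewrite [X in _ * (X + _ + _ + _)]cube// [X in _ * (_ + _ + _ + X)]cube//.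
  by field.
split.
  have -> : (fun nu : R => mxpow A nu *m X *m mxpow B (1 - nu)) =
      (fun nu => T (fun i j => a i `^ nu * b j `^ (1 - nu))).
    by apply/funext => nu; exact: TE.
  rewrite Tint.
  apply: Tle => // i j; rewrite Rintegral_powR_mul_le// andbT.
  by apply: Rintegral_ge0 => t _; rewrite mulr_ge0 ?powR_ge0.
rewrite !TE AXE XBE (natVC 2) (natC 2) !TD !TZ !TD.
(* The factor 1 / 3 moves into the norm and then into the kernel, so that [Tle] applies. *)
rewrite -frobeniusZ ?divr_ge0// TZ.
apply: Tle => // i j; apply/andP; split.
  by rewrite exprn_ge0// divr_ge0// addr_ge0// powR_ge0.
by rewrite [X in _ + X]mulrC cube_mean_le.
Qed.
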